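(* Let $d\ge 2$, let $\widehat F_d$ be the free profinite group of rank $d$, let $w=w(x,\boldsymbol y)$ be a word in $k+1$ variables, and let $\eta_w(x)$ be the formula $\exists\boldsymbol y:\ w(x,\boldsymbol y)=1$. Then the sentence $\forall x:\eta_w(x)$ is true in $\widehat F_d$ if and only if it is true in every group.
   Context: A word $w(x,\boldsymbol y)$ in $k+1$ variables is an element of the abstract free group on $x,y_1,\dots,y_k$, where $\boldsymbol y=(y_1,\dots,y_k)$. *)

(* Defs.v *)
From HB Require Import structures.
From mathcomp Require Import all_boot.
From mathcomp Require Import boolp classical_sets functions cardinality.

Set Implicit Arguments.
Unset Strict Implicit.
Unset Printing Implicit Defensive.

Local Open Scope group_scope.
Local Open Scope classical_set_scope.

Section FreeGroup.
Variable I : choiceType.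

(* [(i, true)] is the generator indexed by [i], [(i, false)] its inverse *)
Local Notation letter := (I * bool)%type.

Definition inv_letter (a : letter) : letter := (a.1, ~~ a.2).

Definition reduced (s : seq letter) : bool :=
  sorted (fun a b => b != inv_letter a) s.

Definition push_letter (a : letter) (s : seq letter) : seq letter :=
  if s is b :: s' then if b == inv_letter a then s' else a :: s else [:: a].

Definition reduced_cat (s t : seq letter) : seq letter :=
  foldr push_letter t s.

Definition inv_word (s : seq letter) : seq letter :=
  rev (map inv_letter s).

Lemma inv_letterK : involutive inv_letter.
Proof. by case=> i b; rewrite /inv_letter /= negbK. Qed.

Lemma reduced_behead a s : reduced (a :: s) -> reduced s.
Proof. exact: path_sorted. Qed.

Lemma reduced_push a s : reduced s -> reduced (push_letter a s).
Proof.
case: s => [//|b s] rs /=; case: ifP => [_|neq_ba].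
  exact: reduced_behead rs.
by rewrite /reduced /= neq_ba.
Qed.

Lemma push_letterK a s :
  reduced s -> push_letter (inv_letter a) (push_letter a s) = s.
Proof.
case: s => [|b s] rs /=; first by rewrite inv_letterK eqxx.
case: eqP rs => [->|_ _]; last by rewrite /= inv_letterK eqxx.
case: s => [//|c s]; rewrite /=.
by rewrite /reduced /= => /andP[/negPf->].
Qed.

Lemma reduced_reduced_cat s t : reduced t -> reduced (reduced_cat s t).
Proof. by move=> rt; elim: s => //= a s; apply: reduced_push. Qed.

Lemma reduced_cat0 s : reduced s -> reduced_cat s [::] = s.
Proof.
elim: s => //= a s IHs rs; rewrite (IHs (reduced_behead rs)).
by case: s rs {IHs} => //= b s; rewrite /reduced /= => /andP[/negPf->].
Qed.

Lemma reduced_cat_push a s t :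
  reduced t -> reduced_cat (push_letter a s) t = push_letter a (reduced_cat s t).
Proof.
move=> rt; case: s => [//|b s] /=; case: eqP => //= ->.
have := @push_letterK (inv_letter a) _ (reduced_reduced_cat s rt).
by rewrite inv_letterK.
Qed.

Lemma reduced_catA s t u : reduced u ->
  reduced_cat s (reduced_cat t u) = reduced_cat (reduced_cat s t) u.
Proof. by move=> ru; elim: s => //= a s ->; rewrite reduced_cat_push. Qed.

Lemma inv_wordK : involutive inv_word.
Proof.
by move=> s; rewrite /inv_word map_rev revK mapK //; apply: inv_letterK.
Qed.

Lemma reduced_inv s : reduced s -> reduced (inv_word s).
Proof.
rewrite /reduced /inv_word rev_sorted sorted_map; apply: sub_sorted => a b.
by apply: contra_neq => /= ->; rewrite inv_letterK.
Qed.

Lemma reduced_cat_inv s : reduced s -> reduced_cat (inv_word s) s = [::].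
Proof.
move=> rs; rewrite -{2}(reduced_cat0 rs).
suff H t : reduced t -> reduced_cat (inv_word s) (reduced_cat s t) = t by exact: H.
move=> rt; elim: s {rs} => //= a s IHs.
rewrite /inv_word /= rev_cons /reduced_cat foldr_rcons.
by rewrite push_letterK ?reduced_reduced_cat.
Qed.

Record free_group : Type :=
  FreeGroup { word_of : seq letter; word_reduced : reduced word_of }.

HB.instance Definition _ := [isSub for word_of].
HB.instance Definition _ := [Choice of free_group by <:].

Definition free_one : free_group := @FreeGroup [::] isT.
Definition free_mul (u v : free_group) : free_group :=
  FreeGroup (reduced_reduced_cat (word_of u) (word_reduced v)).
Definition free_inv (u : free_group) : free_group :=
  FreeGroup (reduced_inv (word_reduced u)).

Lemma free_mulA : associative free_mul.
Proof. by move=> u v w; apply: val_inj; apply/reduced_catA/word_reduced. Qed.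
Lemma free_mul1 : left_id free_one free_mul.
Proof. by move=> u; apply: val_inj. Qed.
Lemma free_mulr1 : right_id free_one free_mul.
Proof. by move=> u; apply: val_inj; apply/reduced_cat0/word_reduced. Qed.
Lemma free_mulV : left_inverse free_one free_inv free_mul.
Proof. by move=> u; apply: val_inj; apply/reduced_cat_inv/word_reduced. Qed.
Lemma free_mulrV : right_inverse free_one free_inv free_mul.
Proof.
move=> u; apply: val_inj; rewrite /= -{1}[word_of u]inv_wordK.
exact/reduced_cat_inv/reduced_inv/word_reduced.
Qed.

HB.instance Definition _ := isGroup.Build free_group
  free_mulA free_mul1 free_mulr1 free_mulV free_mulrV.

Definition free_gen (i : I) : free_group := @FreeGroup [:: (i, true)] isT.

Variables (G : groupType) (f : I -> G).

Definition eval_letter (a : letter) : G := if a.2 then f a.1 else (f a.1)^-1.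

Definition eval_word (w : free_group) : G :=
  \prod_(a <- word_of w) eval_letter a.

Lemma eval_inv_letter a : eval_letter (inv_letter a) = (eval_letter a)^-1.
Proof. by case: a => i [] /=; rewrite /eval_letter /= ?invgK. Qed.

Lemma eval_wordM : {morph eval_word : u v / u * v}.
Proof.
case=> s rs [t rt]; rewrite /eval_word /= {rs rt}; elim: s => [|a s IHs] /=.
  by rewrite big_nil mul1g.
rewrite big_cons -mulgA -{}IHs; case: (reduced_cat s t) => [|b u] /=.
  by rewrite big_seq1 big_nil mulg1.
case: eqP => [->|_]; last by rewrite big_cons.
by rewrite big_cons eval_inv_letter mulVKg.
Qed.

Lemma eval_word_gen i : eval_word (free_gen i) = f i.
Proof. by rewrite /eval_word big_seq1. Qed.

Lemma morph1V (H : groupType) (h : H -> G) : {morph h : u v / u * v} ->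
  h 1 = 1 /\ {morph h : u / u^-1}.
Proof.
move=> hM; have h1 : h 1 = 1 by apply: (mulgI (h 1)); rewrite -hM !mulg1.
by split=> // u; apply/esym/mulg1_eq; rewrite -hM mulgV.
Qed.

Lemma eval_word_unique (h : free_group -> G) : {morph h : u v / u * v} ->
  (forall i, h (free_gen i) = f i) -> h =1 eval_word.
Proof.
move=> hM hf [s rs]; have [h1 hV] := morph1V hM.
rewrite /eval_word /=; elim: s rs => [|[i b] s IHs] rs.
  by rewrite big_nil -h1; congr h; apply: val_inj.
rewrite big_cons -(IHs (reduced_behead rs)).
have -> : eval_letter (i, b) = h (@FreeGroup [:: (i, b)] isT).
  rewrite /eval_letter -hf; case: b {rs} => /=; first by congr h; apply: val_inj.
  by rewrite -hV; congr h; apply: val_inj.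
rewrite -hM; congr h; apply: val_inj => /=.
by move: rs; case: s {IHs} => [|b' s] //=; rewrite /reduced /= => /andP[/negPf->].
Qed.

End FreeGroup.

Section Completion.
Variable G : groupType.

Definition lcoset_of (N : set G) (a : G) : set G := [set a * n | n in N].

Record fin_index_normal : Type := FinIndexNormal {
  fin_set :> set G;
  fin_set1 : fin_set 1;
  fin_setM : forall a b, fin_set a -> fin_set b -> fin_set (a * b);
  fin_setV : forall a, fin_set a -> fin_set a^-1;
  fin_setJ : forall a b, fin_set a -> fin_set (a ^ b);
  fin_setI : finite_set (range (lcoset_of fin_set)) }.

(* The inverse limit of the finite quotients G / N.  An element is a family   *)
(* of cosets; for M `<=` N the transition map G / M -> G / N sends a coset of *)
(* M to the unique coset of N that contains it.                               *)
Record completion : Type := Completion {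
  comp_at :> fin_index_normal -> set G;
  comp_coset : forall N, exists a, comp_at N = lcoset_of N a;
  comp_compat : forall M N : fin_index_normal,
    M `<=` N -> comp_at M `<=` comp_at N }.

HB.instance Definition _ := gen_eqMixin completion.
HB.instance Definition _ := gen_choiceMixin completion.

Lemma completion_eq (x y : completion) : (forall N, x N = y N) -> x = y.
Proof.
case: x y => [x cx tx] [y cy ty] /= /funext exy; subst y.
by congr Completion; exact: Prop_irrelevance.
Qed.

Implicit Types (M N : fin_index_normal) (a b c : G).

Lemma lcoset_ofP N a b : lcoset_of N a b <-> fin_set N (a^-1 * b).
Proof.
split=> [[n Nn <-]|Nab]; first by rewrite mulKg.
by exists (a^-1 * b) => //; rewrite mulVKg.
Qed.

Lemma lcoset_of_refl N a : lcoset_of N a a.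
Proof. by apply/lcoset_ofP; rewrite mulVg; exact: fin_set1. Qed.

Lemma lcoset_of_eq N a b : lcoset_of N a b -> lcoset_of N a = lcoset_of N b.
Proof.
move=> /lcoset_ofP Nab; apply/seteqP; split=> c /lcoset_ofP Nc; apply/lcoset_ofP.
  have -> : b^-1 * c = (a^-1 * b)^-1 * (a^-1 * c).
    by rewrite invgM invgK -mulgA mulVKg.
  by apply: fin_setM => //; apply: fin_setV.
have -> : a^-1 * c = (a^-1 * b) * (b^-1 * c) by rewrite -mulgA mulVKg.
exact: fin_setM.
Qed.

Lemma comp_atE (x : completion) N a : x N a -> x N = lcoset_of N a.
Proof. by have [b ->] := comp_coset x N; apply: lcoset_of_eq. Qed.

Lemma lcoset_ofM N a b :
  [set u * v | u in lcoset_of N a & v in lcoset_of N b] = lcoset_of N (a * b).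
Proof.
apply/seteqP; split=> c /=.
  move=> [u /lcoset_ofP Nu [v /lcoset_ofP Nv <-]]; apply/lcoset_ofP.
  have -> : (a * b)^-1 * (u * v) = ((a^-1 * u) ^ b) * (b^-1 * v).
    by rewrite conjgE invgM -!mulgA mulVKg.
  by apply: fin_setM => //; apply: fin_setJ.
move=> /lcoset_ofP Nc; exists a; first exact: lcoset_of_refl.
exists (a^-1 * c); last by rewrite mulVKg.
by apply/lcoset_ofP; rewrite mulgA -invgM.
Qed.

Lemma lcoset_ofV N a : [set u^-1 | u in lcoset_of N a] = lcoset_of N a^-1.
Proof.
have aux b c : fin_set N (b^-1 * c) -> fin_set N (b * c^-1).
  move=> /(fin_setJ b^-1)/fin_setV.
  by rewrite conjgE invgK -mulgA mulVKg invgM invgK.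
apply/seteqP; split=> c /=.
  by move=> [u /lcoset_ofP Nu <-]; apply/lcoset_ofP; rewrite invgK; apply: aux.
move=> /lcoset_ofP Nc; exists c^-1; last by rewrite invgK.
by apply/lcoset_ofP; have := aux _ _ Nc.
Qed.

Lemma lcoset_of1 N : lcoset_of N 1 = N.
Proof.
by apply/seteqP; split=> a; rewrite lcoset_ofP invg1 mul1g.
Qed.

Lemma in_completion_coset a N : exists b, lcoset_of N a = lcoset_of N b.
Proof. by exists a. Qed.
Lemma in_completion_compat a M N :
  M `<=` N -> lcoset_of M a `<=` lcoset_of N a.
Proof. by move=> MN; apply: image_subset. Qed.

Definition in_completion (a : G) : completion :=
  Completion (in_completion_coset a) (@in_completion_compat a).

Section Mul.
Variables x y : completion.
Definition comp_mul_at N : set G := [set u * v | u in x N & v in y N].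
Lemma comp_mul_coset N : exists a, comp_mul_at N = lcoset_of N a.
Proof.
have [a ea] := comp_coset x N; have [b eb] := comp_coset y N.
by exists (a * b); rewrite /comp_mul_at ea eb lcoset_ofM.
Qed.
Lemma comp_mul_compat M N : M `<=` N -> comp_mul_at M `<=` comp_mul_at N.
Proof.
move=> MN c [u xu [v yv <-]]; exists u; first exact: comp_compat MN _ xu.
by exists v => //; exact: comp_compat MN _ yv.
Qed.
Definition comp_mul : completion := Completion comp_mul_coset comp_mul_compat.
End Mul.

Section Inv.
Variable x : completion.
Definition comp_inv_at N : set G := [set u^-1 | u in x N].
Lemma comp_inv_coset N : exists a, comp_inv_at N = lcoset_of N a.
Proof.
by have [a ea] := comp_coset x N; exists a^-1; rewrite /comp_inv_at ea lcoset_ofV.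
Qed.
Lemma comp_inv_compat M N : M `<=` N -> comp_inv_at M `<=` comp_inv_at N.
Proof. by move=> MN; apply: image_subset; apply: comp_compat. Qed.
Definition comp_inv : completion := Completion comp_inv_coset comp_inv_compat.
End Inv.

Definition comp_one : completion := in_completion 1.

Lemma fin_kernel (Q : groupType) (h : G -> Q) :
  finite_set [set: Q] -> {morph h : a b / a * b} ->
  exists N, fin_set N = [set a | h a = 1].
Proof.
move=> finQ hM; have [h1 hV] := morph1V hM.
unshelve eexists (@FinIndexNormal [set a | h a = 1] h1 _ _ _ _) => //=.
- by move=> a b; rewrite hM => -> ->; rewrite mulg1.
- by move=> a; rewrite hV => ->; rewrite invg1.
- by move=> a b ha; rewrite conjgE !hM ha mul1g hV mulVg.
apply: sub_finite_set (finite_image (fun q => [set b | h b = q]) finQ).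
move=> _ [a _ <-]; exists (h a) => //; apply/seteqP; split=> b /=.
  by move=> hb; exists (a^-1 * b); rewrite /= ?mulVKg // hM hb hV mulVg.
by move=> [c hc <-]; rewrite hM hc mulg1.
Qed.

Lemma fin_meet M N : exists K : fin_index_normal, K `<=` M /\ K `<=` N.
Proof.
unshelve eexists (@FinIndexNormal (M `&` N) _ _ _ _ _).
- by split; apply: fin_set1.
- by move=> a b [? ?] [? ?]; split; apply: fin_setM.
- by move=> a [? ?]; split; apply: fin_setV.
- by move=> a b [? ?]; split; apply: fin_setJ.
- apply: sub_finite_set (finite_image2 setI (fin_setI M) (fin_setI N)).
  move=> _ [a _ <-]; exists (lcoset_of M a); first by exists a.
  exists (lcoset_of N a); first by exists a.
  apply/seteqP; split=> b /=.
    by move=> [/lcoset_ofP Mb /lcoset_ofP Nb]; exists (a^-1 * b); rewrite ?mulVKg.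
  by move=> [n [Mn Nn] <-]; split; exists n.
by split=> a [].
Qed.

Lemma comp_mulA : associative comp_mul.
Proof.
move=> x y z; apply: completion_eq => N; rewrite /= /comp_mul_at /= /comp_mul_at.
have [[a ->] [b ->] [c ->]] := And3 (comp_coset x N) (comp_coset y N) (comp_coset z N).
by rewrite !lcoset_ofM mulgA.
Qed.
Lemma comp_mul1 : left_id comp_one comp_mul.
Proof.
move=> x; apply: completion_eq => N; rewrite /= /comp_mul_at /=.
by have [a ->] := comp_coset x N; rewrite lcoset_ofM mul1g.
Qed.
Lemma comp_mulr1 : right_id comp_one comp_mul.
Proof.
move=> x; apply: completion_eq => N; rewrite /= /comp_mul_at /=.
by have [a ->] := comp_coset x N; rewrite lcoset_ofM mulg1.
Qed.
Lemma comp_mulV : left_inverse comp_one comp_inv comp_mul.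
Proof.
move=> x; apply: completion_eq => N; rewrite /= /comp_mul_at /= /comp_inv_at.
by have [a ->] := comp_coset x N; rewrite lcoset_ofV lcoset_ofM mulVg.
Qed.
Lemma comp_mulrV : right_inverse comp_one comp_inv comp_mul.
Proof.
move=> x; apply: completion_eq => N; rewrite /= /comp_mul_at /= /comp_inv_at.
by have [a ->] := comp_coset x N; rewrite lcoset_ofV lcoset_ofM mulgV.
Qed.

HB.instance Definition _ := isGroup.Build completion
  comp_mulA comp_mul1 comp_mulr1 comp_mulV comp_mulrV.

Lemma in_completionM : {morph in_completion : a b / a * b}.
Proof. by move=> a b; apply: completion_eq => N; rewrite /= -lcoset_ofM. Qed.

End Completion.

(* The free profinite group of rank d is the profinite completion of the      *)
(* free group of rank d; see free_profinite_universal.                        *)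
Definition free_profinite (d : nat) : groupType :=
  completion (free_group 'I_d).

(* A morphism from a profinite group to a finite one is continuous exactly    *)
(* when it factors through one of the projections of the inverse limit.       *)
Definition comp_continuous (G Q : groupType) (g : completion G -> Q) : Prop :=
  exists N, forall x y : completion G, x N = y N -> g x = g y.

Lemma free_profinite_universal (d : nat) (Q : groupType) (f : 'I_d -> Q) :
  finite_set [set: Q] ->
  exists! g : free_profinite d -> Q,
    [/\ {morph g : x y / x * y}, comp_continuous g
      & forall i, g (in_completion (free_gen i)) = f i].
Proof.
move=> finQ; have hM := eval_wordM f.
have [N eN] := fin_kernel finQ hM.
pose rep (x : free_profinite d) := sval (cid (comp_coset x N)).
have repE (x : free_profinite d) a : x N a -> eval_word f (rep x) = eval_word f a.
  rewrite /rep; case: cid => b /= -> /lcoset_ofP; rewrite eN /= => hab.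
  by rewrite -[a](mulVKg b) hM hab mulg1.
have mem (x : free_profinite d) : x N (rep x).
  by rewrite /rep; case: cid => b /= ->; apply: lcoset_of_refl.
exists (fun x => eval_word f (rep x)); split.
  split=> [x y||i].
  - rewrite -hM; apply: repE.
    by exists (rep x) => //; exists (rep y).
  - by exists N => x y exy; apply: repE; rewrite exy.
  by rewrite -(eval_word_gen f i); apply: repE; apply: lcoset_of_refl.
move=> g [gM [M gK] gf]; apply/funext => x.
have [K [KM KN]] := fin_meet M N; have [a ea] := comp_coset x K.
have xKa : x K a by rewrite ea; apply: lcoset_of_refl.
rewrite (repE x a (comp_compat KN xKa)).
rewrite (gK x (in_completion a)).
  rewrite -(@eval_word_unique _ _ f (g \o @in_completion _)) //= => u v /=.
  by rewrite in_completionM gM.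
by rewrite (comp_atE (comp_compat KM xKa)).
Qed.

(* [None] is the variable x and [Some i] is the variable y_i *)
Definition word (k : nat) : groupType := free_group (option 'I_k).

Definition word_val (k : nat) (G : groupType) (w : word k)
    (x : G) (y : 'I_k -> G) : G :=
  eval_word (fun v => if v is Some i then y i else x) w.

Definition eta_formula (k : nat) (w : word k) (G : groupType) (x : G) : Prop :=
  exists y : 'I_k -> G, word_val w x y = 1.

(* Main.v *)
Require Import Defs.
From mathcomp Require Import all_boot.
From mathcomp Require Import all_fingroup all_algebra cyclic.
From mathcomp Require Import classical_sets cardinality.

(** Only the exponent sums of [w] matter.  Let [a] be that of [x], and [g] the
    gcd of those of the [y_i].  A solution in every finite cyclic quotient of
    the free profinite group, for [x] a generator, forces [g %| a]; then Bezout
    coefficients give integers [c_i] such that [y_i = x ^ c_i] solves the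
    equation in every group. *)

Set Implicit Arguments.
Unset Strict Implicit.
Unset Printing Implicit Defensive.

Import GRing.Theory.
Local Open Scope group_scope.

Section IntegerPowers.
Variables (G : groupType) (x : G).

Definition zexpg (z : int) : G :=
  match z with Posz n => x ^+ n | Negz n => x ^- n.+1 end.

Lemma zexpg_succ z : zexpg (z + 1)%R = zexpg z * x.
Proof.
case: z => [n|[|n]].
- by rewrite addrC -intS /= expgSr.
- by rewrite NegzE addNr /= expg1 mulVg.
- by rewrite !NegzE intS opprD addrAC addNr add0r -NegzE /=
     (expgS x n.+1) invgM mulgKV.
Qed.

Lemma zexpgD : {morph zexpg : z t / (z + t)%R >-> z * t}.
Proof.
have succV z : zexpg (z - 1)%R = zexpg z * x^-1.
  by rewrite -{2}[z](subrK 1%R) zexpg_succ mulgK.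
move=> z t; elim/int_ind: t => [|n IHn|n IHn].
- by rewrite addr0 /= mulg1.
- by rewrite intS (addrC 1%R) addrA !zexpg_succ IHn mulgA.
- by rewrite intS opprD (addrC (- 1)%R) addrA !succV IHn mulgA.
Qed.

Lemma zexpgN z : zexpg (- z)%R = (zexpg z)^-1.
Proof. by apply/esym/mulg1_eq; rewrite -zexpgD subrr. Qed.

Lemma zexpg_eq1 z : (zexpg z == 1) = (x ^+ `|z|%N == 1).
Proof. by case: z => n //=; rewrite invg_eq1. Qed.

End IntegerPowers.

Definition exponent_sum (I : choiceType) (w : free_group I) (i : I) : int :=
  (\sum_(a <- word_of w | i == a.1) (if a.2 then 1 else -1))%R.

(** Powers of a single [x] commute, so the evaluation factors through the abelianization of the free
    group, where only exponent sums survive. *)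
Lemma eval_word_zexpg (I : finType) (G : groupType) (x : G) (c : I -> int)
    (w : free_group I) :
  eval_word (fun i => zexpg x (c i)) w
    = zexpg x (\sum_i c i * exponent_sum w i)%R.
Proof.
have -> : (\sum_i c i * exponent_sum w i
           = \sum_(a <- word_of w) (if a.2 then c a.1 else - c a.1))%R.
  under eq_bigr do rewrite /exponent_sum big_distrr big_mkcond /=.
  rewrite exchange_big; apply: eq_bigr => -[i b] _ /=.
  rewrite -big_mkcond big_pred1_eq.
  by case: b; rewrite ?mulr1 ?mulrN1.
rewrite (big_morph _ (@zexpgD G x) (erefl : zexpg x 0 = 1)).
by apply: eq_bigr => -[i []] _; rewrite /eval_letter /= ?zexpgN.
Qed.

Lemma morph_eval_word (I : choiceType) (G H : groupType) (g : G -> H)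
    (f : I -> G) (w : free_group I) : {morph g : u v / u * v} ->
  g (eval_word f w) = eval_word (g \o f) w.
Proof.
move=> gM; apply: (@eval_word_unique _ _ (g \o f) (g \o eval_word f)) => [u v|i].
  by rewrite /= eval_wordM gM.
by rewrite /= eval_word_gen.
Qed.

Lemma big_gcdn_Bezout (I : finType) (P : pred I) (b : I -> int) :
  exists c : I -> int,
    (\sum_(i | P i) c i * b i = (\big[gcdn/0]_(i | P i) `|b i|)%N%:Z)%R.
Proof.
elim/big_rec: (\big[_/_]_(_ | _) _) => [|i n Pi [c ec]].
  by exists (fun=> 0%R); rewrite big1 // => i _; rewrite mul0r.
have [u [v uv]] := Bezoutz (b i) n%:Z.
(* The invariant is that [n] is a combination of all the [b j]; scaling it by [v] and adding [u]
   copies of [b i] gives the new gcd. *)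
exists (fun j => v * c j + u * (j == i)%:R)%R.
under eq_bigr do rewrite mulrDl -!mulrA.
rewrite big_split /= -!big_distrr /= ec (bigD1 i) //= eqxx mul1r big1 => [|j].
  by rewrite addr0 addrC uv /gcdz absz_nat.
by case/andP=> _ /negPf->; rewrite mul0r.
Qed.

(** For [g > 0] the modulus [g] itself suffices. For [g = 0] every positive integer divides [a], in
    particular [a.+1], which forces [a = 0]. *)
Lemma dvdn_gcdn_all (a g : nat) : (forall n, gcdn n.+1 g %| a) -> g %| a.
Proof.
case: g => [|g] dvd; last by have := dvd g; rewrite gcdnn.
have := dvd a; rewrite gcdn0; case: a {dvd} => // a dvd.
by have := dvdn_leq (ltn0Sn a) dvd; rewrite ltnn.
Qed.

Theorem corollary4p15 (d : nat) (hd : (2 <= d)%N) (k : nat) (w : word k) :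
  (forall x : free_profinite d, eta_formula w x) <->
  (forall (G : groupType) (x : G), eta_formula w x).
Proof.
split=> [solF G x | sol x]; last exact: sol.
pose e := exponent_sum w; pose y_var (v : option 'I_k) := v != None.
pose g := \big[gcdn/0]_(v | y_var v) `|e v|%N.
have [c ec] := big_gcdn_Bezout y_var e.
suff /dvdnP[q eq_aq] : g %| `|e None|%N.
  (* Chosen so that [e None + s * g = 0], given [|e None| = q * g]. *)
  pose s := (- sgz (e None) * q%:Z)%R.
  pose c' (v : option 'I_k) : int := if v is Some _ then (s * c v)%R else 1%R.
  exists (fun i => zexpg x (c' (Some i))).
  have -> : word_val w x (fun i => zexpg x (c' (Some i)))
            = eval_word (fun v => zexpg x (c' v)) w.
    by apply: eq_bigr => -[[i|] b] _; rewrite /eval_letter //= expg1.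
  rewrite eval_word_zexpg (bigD1 None) //= mul1r -/(e None).
  have -> : (\sum_(v | y_var v) c' v * e v = s * g%:Z)%R.
    rewrite -ec big_distrr; apply: eq_bigr => -[i|] //= _.
    by rewrite mulrA.
  by rewrite /s -mulrA -PoszM -eq_aq mulNr {1}[e None]intEsg abszE subrr.
apply: dvdn_gcdn_all => n.
pose t : 'I_n.+1 := Zp1.
have finQ : finite_set [set: 'I_n.+1] by exact: finite_finset.
(* [h] maps onto the cyclic group of order [n.+1], sending every free generator to [t]. *)
have [h [[hM _ hgen] _]] := free_profinite_universal (fun _ : 'I_d => t) finQ.
have [y ey] := solF (in_completion (free_gen (Ordinal (ltnW hd)))).
(* An element of ['I_n.+1] is [t] raised to its own value, so the image of the solution under [h]
   consists of powers of [t]. *)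
pose c' (v : option 'I_k) : int := if v is Some i then Posz (h (y i)) else 1%R.
have [h1 _] := morph1V hM.
move: ey; rewrite /word_val => /(congr1 h); rewrite h1 morph_eval_word //.
have -> : h \o (fun v => if v is Some i then y i
                        else in_completion (free_gen (Ordinal (ltnW hd))))
          = (fun v => zexpg t (c' v)).
  apply: boolp.funext => -[i|] /=; last by rewrite hgen expg1.
  by rewrite Zp1_expgz.
rewrite eval_word_zexpg => /eqP; rewrite zexpg_eq1 -order_dvdn order_Zp1.
rewrite (bigD1 None) //= mul1r -/e => dvd_n.
(* Whatever the [y i] are, their contribution is a multiple of [g]; modulo [gcdn n.+1 g] only
   [e None] remains. *)
have dvd_g : (gcdn n.+1 g %| (\sum_(v | y_var v) c' v * e v)%R)%Z.
  apply: rpred_sum => v Pv.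
  apply: dvdz_mull; rewrite dvdzE absz_nat.
  by apply: dvdn_trans (dvdn_gcdr _ _) _; rewrite /g (bigD1 v) //= dvdn_gcdl.
rewrite -[X in X %| _]absz_nat -dvdzE -(rpredDr _ dvd_g).
by rewrite dvdzE absz_nat (dvdn_trans (dvdn_gcdl _ _)).
Qed.
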